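(* There exist absolute constants $c,C,C'>0$ such that the following holds: there is an event of probability at least $1-c/(n\vee m)^4$ on which, for every integer $s_0\in[n]$ satisfying $$\frac{\sum_{j=1}^m a_{jj}p_j^2}{\|A_0\|_2}\ \ge\ C\,\psi_B^2(s_0)\log(n\vee m),$$ one has $$\sup_{q\in\mathbb{S}^{n-1},\ s_0\text{-sparse}}\|A^{\diamond}_{qq}\|_F\ \le\ C'\,W\,\|B_0\|_2\,\|A_0\|_2^{1/2},\qquad W=\Big(a_\infty\sum_{s=1}^mp_s^2\Big)^{1/2}+\psi_B(s_0)\Big(a_\infty\|A_0\|_2\sum_{j=1}^mp_j^4\,\log(n\vee m)\Big)^{1/4},$$ where $$A^{\diamond}_{qq}=\sum_{k=1}^m\sum_{i\ne j}u^k_iu^k_j\,q_iq_j\,(c_jc_i^T)\otimes(d_kd_k^T)\in\mathbb{R}^{mn\times mn}.$$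
   Context: $[n]=\{1,\dots,n\}$; $x\vee y=\max(x,y)$. $A_0=(a_{ij})\in\mathbb{R}^{m\times m}$ and $B_0=(b_{ij})\in\mathbb{R}^{n\times n}$ are symmetric positive definite, $\mathrm{tr}(B_0)=n$, $a_\infty=\max_ja_{jj}$. $A_0^{1/2}=[d_1,\dots,d_m]$ and $B_0^{1/2}=[c_1,\dots,c_n]$ are the symmetric positive definite square roots, written by columns. $U=[u^1|\cdots|u^m]\in\{0,1\}^{n\times m}$ is a random mask with mutually independent entries, $u^k_i\sim\mathrm{Bernoulli}(p_k)$ for $i=1,\dots,n$, $p_k\in[0,1]$. $\otimes$ is the Kronecker product; $\|\cdot\|_2$ is the operator (or Euclidean) norm, $\|\cdot\|_F$ the Frobenius norm, $\mathbb{S}^{n-1}$ the unit sphere of $\mathbb{R}^n$; a vector is $s_0$-sparse if it has at most $s_0$ nonzero entries; $\sum_{i\ne j}$ is over ordered pairs of distinct indices. $\psi_B(s)=\rho_{\max}(s,|B_0|)/\|B_0\|_2$ with $\rho_{\max}(s,|B_0|)=\max\{\sum_{i,j}|b_{ij}||q_i||q_j| : q\in\mathbb{S}^{n-1}\ s\text{-sparse}\}$. Absolute constants are independent of $n,m,s_0,A_0,B_0,(p_k)$. *)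

(* Defs.v *)
From HB Require Import structures.
From mathcomp Require Import all_boot all_order all_algebra.
From mathcomp Require Import all_classical all_reals all_analysis.
From mathcomp Require Import mxtens.

Import Order.TTheory GRing.Theory Num.Theory.
Import numFieldNormedType.Exports.

Local Open Scope classical_set_scope.
Local Open Scope ring_scope.

Section Matrices.
Context {R : realType}.

Definition l2norm {n} (x : 'cV[R]_n) : R := Num.sqrt (\sum_i x i 0 ^+ 2).

Definition l2sphere n : set 'cV[R]_n := [set x | l2norm x = 1].

(* For 0 < n this is a supremum of a nonempty bounded set of reals, so the
   convention that sup is 0 outside that case plays no role. *)
Definition opnorm {m n} (M : 'M[R]_(m, n)) : R :=
  sup [set l2norm (M *m x) | x in l2sphere n].

Definition frobnorm {m n} (M : 'M[R]_(m, n)) : R :=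
  Num.sqrt (\sum_i \sum_j M i j ^+ 2).

Definition spd {n} (M : 'M[R]_n) : Prop :=
  M^T = M /\ forall x : 'cV[R]_n, x != 0 -> 0 < (x^T *m M *m x) 0 0.

Definition is_spd_sqrt {n} (M S : 'M[R]_n) : Prop := spd S /\ S *m S = M.

Definition sparse {n} (s : nat) (x : 'cV[R]_n) : bool :=
  (#|[pred i | (x i 0 != 0)%R]| <= s)%N.

Definition sparse_sphere n (s : nat) : set 'cV[R]_n :=
  [set q | l2sphere n q /\ sparse s q].

(* rho_max s M is $\rho_{\max}(s, |M|)$: the entrywise absolute value is taken
   here, not by the caller. For 0 < n and 0 < s the maximum is attained, over a
   nonempty compact set. *)
Definition rho_max {n} (s : nat) (M : 'M[R]_n) : R :=
  sup [set \sum_i \sum_j `|M i j| * `|q i 0| * `|q j 0|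
      | q in sparse_sphere n s].

Definition psi {n} (M : 'M[R]_n) (s : nat) : R := rho_max s M / opnorm M.

(* The default 0 is harmless for a matrix with positive diagonal. *)
Definition max_diag {n} (M : 'M[R]_n) : R := \big[Num.max/0]_j M j j.

(* SA and SB stand for $A_0^{1/2}$ and $B_0^{1/2}$, and u i k is the entry in
   row i of the k-th column $u^k$ of the mask. *)
Definition Adiamond {m n} (SA : 'M[R]_m) (SB : 'M[R]_n)
    (u : 'I_n -> 'I_m -> bool) (q : 'cV[R]_n) : 'M[R]_(n * m) :=
  \sum_k \sum_i \sum_(j | i != j)
    ((u i k)%:R * (u j k)%:R * q i 0 * q j 0) *:
      ((col j SB *m (col i SB)^T) *t (col k SA *m (col k SA)^T)).

Definition Wbound {m n} (A0 : 'M[R]_m) (B0 : 'M[R]_n) (p : 'I_m -> R)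
    (s0 : nat) : R :=
  Num.sqrt (max_diag A0 * \sum_k p k ^+ 2) +
  psi B0 s0 *
    (max_diag A0 * opnorm A0 * (\sum_k p k ^+ 4) * ln (maxn n m)%:R) `^ 4^-1.

End Matrices.

Definition mutually_independent {R : realType} {d d' : measure_display}
    {T : measurableType d} {T' : measurableType d'} (P : probability T R)
    {I : finType} (X : I -> {RV P >-> T'}) : Prop :=
  forall (J : {set I}) (B : I -> set T'), (forall i, measurable (B i)) ->
    P (\bigcap_(i in [set` J]) X i @^-1` B i) =
    (\prod_(i in J) P (X i @^-1` B i))%E.

(* Main.v *)
(* Writing z = (i, j) and y_z(k) = u^k_i u^k_j, the squared Frobenius norm of
   A^<>_qq is the sum over k, l of a_kl^2 T(X_k, X_l), where
   T(X, Y) = sum_(z, z') b_(z1 z'1) b_(z2 z'2) X_z Y_z' and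
   X_k(z) = 1_(i != j) q_i q_j y_z(k).  Two facts make a union bound over the
   at most n^4 pairs (z, z') sufficient for all sparse q at once:
   T(X, X) <= ||B_0||_2^2 |X|^2 without any factor psi_B, and every entrywise
   bound t on deviations costs at most t rho_max(s_0, |B_0|)^2.
   - The terms k = l are nonnegative and only need the upper tail of
     sum_k a_kk^2 y_z(k).
   - For k != l the mean p_k^2 p_l^2 is summed through T(X, X), and the deviation
     of sum_(k != l) a_kl^2 y_z(k) y_z'(l) from its mean is controlled by
     decoupling: the columns of the mask are independent, and the rows of
     (a_kl^2) sum to at most M = ||A_0||_2 a_oo, which gives a sub-gamma tail
     M ((log(n v m) sum_k p_k^4)^(1/2) + log(n v m)).
   The lower bound assumed on sum_j a_jj p_j^2 absorbs the terms in
   psi_B^2 log(n v m). *)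

Require Import Defs.
From HB Require Import structures.
From mathcomp Require Import all_boot all_order all_algebra.
From mathcomp Require Import all_classical all_reals all_analysis.
From mathcomp Require Import mxtens ring lra.

Set Implicit Arguments.
Unset Strict Implicit.
Unset Printing Implicit Defensive.

Import Order.TTheory GRing.Theory Num.Theory.
Import numFieldNormedType.Exports.

Local Open Scope classical_set_scope.
Local Open Scope ring_scope.

(** * Finite expectations *)

Ltac nonneg := do ?[exact: sqr_ge0 | done | apply: mulr_ge0 | rewrite subr_ge0].

Section FiniteExpectation.
Context {R : realType} {C : finType}.
Implicit Types (mu f g : C -> R).

Definition is_pmf mu : Prop := (forall c, 0 <= mu c) /\ \sum_c mu c = 1.

Definition Ex mu f : R := \sum_c mu c * f c.

Lemma ExD mu f g : Ex mu (fun c => f c + g c) = Ex mu f + Ex mu g.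
Proof. by rewrite /Ex -big_split; apply: eq_bigr => c _; rewrite mulrDr. Qed.

Lemma ExZ mu a f : Ex mu (fun c => a * f c) = a * Ex mu f.
Proof. by rewrite /Ex mulr_sumr; apply: eq_bigr => c _; rewrite mulrCA. Qed.

Lemma Ex_cst mu a : is_pmf mu -> Ex mu (fun=> a) = a.
Proof. by move=> [_ mu1]; rewrite /Ex -mulr_suml mu1 mul1r. Qed.

Lemma Ex_sum mu (J : finType) (D : pred J) (f : J -> C -> R) :
  Ex mu (fun c => \sum_(j | D j) f j c) = \sum_(j | D j) Ex mu (f j).
Proof.
by rewrite /Ex exchange_big; apply: eq_bigr => c _; rewrite mulr_sumr.
Qed.

Lemma eq_Ex mu f g : f =1 g -> Ex mu f = Ex mu g.
Proof. by move=> fg; apply: eq_bigr => c _; rewrite fg. Qed.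

Lemma le_Ex mu f g : is_pmf mu -> (forall c, f c <= g c) -> Ex mu f <= Ex mu g.
Proof. by move=> [mu0 _] fg; apply: ler_sum => c _; apply: ler_wpM2l. Qed.

Lemma Ex_ge0 mu f : is_pmf mu -> (forall c, 0 <= f c) -> 0 <= Ex mu f.
Proof. by move=> [mu0 _] f0; apply: sumr_ge0 => c _; apply: mulr_ge0. Qed.

(** Chernoff's bound: [1 <= expR (l * (f c - t))] wherever [t <= f c]. *)
Lemma Ex_markov mu f (l t : R) : is_pmf mu -> 0 <= l ->
  Ex mu (fun c => (t <= f c)%R%:R) <=
  expR (- (l * t)) * Ex mu (fun c => expR (l * f c)).
Proof.
move=> hmu l0; rewrite -ExZ; apply: le_Ex => // c; rewrite -expRD.
have [tf|_] := leP t (f c); last exact: expR_ge0.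
apply: le_trans (expR_ge1Dx _); rewrite lerDl addrC -mulrBr.
by rewrite mulr_ge0// subr_ge0.
Qed.

(** Jensen's inequality, obtained by averaging the tangent line of [expR] at the mean [a]. *)
Lemma expR_Ex_le mu f : is_pmf mu -> expR (Ex mu f) <= Ex mu (expR \o f).
Proof.
move=> hmu; set a := Ex mu f.
have -> : expR a = Ex mu (fun c => expR a * (1 - a + f c)).
  by rewrite ExZ ExD Ex_cst// subrK mulr1.
apply: le_Ex => // c /=; have -> : expR (f c) = expR a * expR (f c - a).
  by rewrite -expRD addrC subrK.
rewrite ler_pM2l ?expR_gt0//; apply: le_trans (expR_ge1Dx _).
by rewrite addrAC addrA.
Qed.

(** From [1 - x <= expR (- x)] follows [expR x <= (1 - x)^-1], and [(1 - x) * (1 + x + 2 * x ^+ 2) =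
    1 + x ^+ 2 * (1 - 2 * x)] is at least 1. *)
Lemma expR_le_quad (x : R) : x <= 2^-1 -> expR x <= 1 + x + 2 * x ^+ 2.
Proof.
move=> x2.
have h := expR_ge1Dx (- x); rewrite expRN in h.
have x1 : 0 < 1 - x by lra.
have : expR x <= (1 - x)^-1.
  by rewrite -[expR x]invrK lef_pV2// posrE ?invr_gt0 ?expR_gt0.
move/le_trans; apply.
rewrite -[leLHS]mul1r ler_pdivrMr//.
have := sqr_ge0 x; rewrite !expr2 => x0; nra.
Qed.

(** A variable with values in [0, 1] has variance at most its mean. The resulting factor [s] in the
    exponent, in place of a bound by the range alone, is what later produces the sums of powers of
    [p k]. *)
Lemma Ex_expR_centered mu f (s a : R) : is_pmf mu ->
  (forall c, 0 <= f c <= 1) -> Ex mu f = s -> `|a| <= 2^-1 ->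
  Ex mu (fun c => expR (a * (f c - s))) <= expR (2 * a ^+ 2 * s).
Proof.
move=> hmu f01 fs a2.
have s0 : 0 <= s by rewrite -fs Ex_ge0// => c; case/andP: (f01 c).
have s1 : s <= 1.
  by rewrite -fs -(Ex_cst 1 hmu) le_Ex// => c; case/andP: (f01 c).
apply: le_trans (expR_ge1Dx _).
(* The quadratic bound with [f c ^+ 2] replaced by the larger [f c]; being affine in [f c], it has
   the explicit mean [1 + 2 * a ^+ 2 * (s - s ^+ 2)]. *)
pose g c := (1 - a * s + 2 * a ^+ 2 * s ^+ 2) +
  (a - 4 * a ^+ 2 * s + 2 * a ^+ 2) * f c.
apply: (@le_trans _ _ (Ex mu g)).
  apply: le_Ex => // c; case/andP: (f01 c) => f0 f1.
  have : a * (f c - s) <= 2^-1.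
    have fsle : `|f c - s| <= 1 by rewrite ler_norml; apply/andP; split; lra.
    apply: le_trans (ler_norm _) _; rewrite normrM.
    by apply: le_trans a2; rewrite ler_piMr.
  move=> /expR_le_quad/le_trans; apply; rewrite /g.
  have : 0 <= a ^+ 2 * (f c * (1 - f c)).
    by rewrite mulr_ge0 ?sqr_ge0// mulr_ge0// subr_ge0.
  rewrite !expr2; nra.
rewrite /g ExD Ex_cst// ExZ fs.
have : 0 <= (a * s) ^+ 2 by exact: sqr_ge0.
rewrite !expr2; nra.
Qed.

End FiniteExpectation.

(** * Product laws on finite function spaces *)

Section ProductExpectation.
Context {R : realType} {I C : finType}.
Implicit Types (mu : I -> C -> R).

Definition prodpmf mu (w : {ffun I -> C}) : R := \prod_i mu i (w i).

Lemma Ex_prodpmf mu (g : I -> C -> R) :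
  Ex (prodpmf mu) (fun w => \prod_i g i (w i)) = \prod_i Ex (mu i) (g i).
Proof.
rewrite /Ex bigA_distr_bigA; apply: eq_bigr => w _.
by rewrite /prodpmf -big_split.
Qed.

Lemma prodpmf_is_pmf mu : (forall i, is_pmf (mu i)) -> is_pmf (prodpmf mu).
Proof.
move=> hmu; split=> [w|]; first by apply: prodr_ge0 => i _; case: (hmu i).
have : Ex (prodpmf mu) (fun=> 1) = 1.
  rewrite (@eq_Ex _ _ _ _ (fun=> \prod_(i : I) 1)) => [|w]; last by rewrite big1_eq.
  rewrite (Ex_prodpmf mu (fun _ _ => 1)).
  by apply: big1 => i _; rewrite Ex_cst.
by rewrite /Ex; under eq_bigr do rewrite mulr1.
Qed.

Lemma Ex_prodpmf_expR_sum mu (g : I -> C -> R) :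
  Ex (prodpmf mu) (fun w => expR (\sum_i g i (w i))) =
  \prod_i Ex (mu i) (fun c => expR (g i c)).
Proof. by rewrite -Ex_prodpmf; apply: eq_Ex => w; rewrite expR_sum. Qed.

Lemma Ex_prodpmf_proj2 mu (g h : C -> R) i j : (forall i, is_pmf (mu i)) ->
  i != j ->
  Ex (prodpmf mu) (fun w => g (w i) * h (w j)) = Ex (mu i) g * Ex (mu j) h.
Proof.
move=> hmu ij; have ji : (j == i) = false by rewrite eq_sym; exact/negbTE.
pose f k c := if k == i then g c else if k == j then h c else 1.
rewrite (@eq_Ex _ _ _ _ (fun w : {ffun I -> C} => \prod_k f k (w k))) => [|w].
  rewrite Ex_prodpmf (bigD1 i)//= (bigD1 j) ?ji//= big1 ?mulr1; last first.
    by move=> k /andP[/negPf ki /negPf kj]; rewrite /f ki kj Ex_cst.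
  by rewrite /f eqxx ji eqxx.
rewrite (bigD1 i)//= (bigD1 j) ?ji//= big1 ?mulr1; last first.
  by move=> k /andP[/negPf ki /negPf kj]; rewrite /f ki kj.
by rewrite /f eqxx ji eqxx.
Qed.

Definition merge (D : pred I) (w w' : {ffun I -> C}) : {ffun I -> C} :=
  [ffun i => if D i then w i else w' i].

(** Exchanging the coordinates outside [D] of two independent copies is an involution that preserves
    their joint weight and turns the first copy into [merge D w w']. *)
Lemma Ex_merge mu (D : pred I) (f : {ffun I -> C} -> R) :
  (forall i, is_pmf (mu i)) ->
  Ex (prodpmf mu) (fun w => Ex (prodpmf mu) (fun w' => f (merge D w w'))) =
  Ex (prodpmf mu) f.
Proof.
move=> hmu.
have -> : Ex (prodpmf mu) f =
    \sum_(ww : {ffun I -> C} * {ffun I -> C})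
      prodpmf mu ww.1 * prodpmf mu ww.2 * f ww.1.
  rewrite -(pair_bigA _ (fun w w' => prodpmf mu w * prodpmf mu w' * f w))/=.
  apply: eq_bigr => w _; rewrite -mulr_suml -mulr_sumr.
  by have [_ ->] := prodpmf_is_pmf hmu; rewrite mulr1.
pose s (ww : {ffun I -> C} * {ffun I -> C}) :=
  (merge D ww.1 ww.2, merge D ww.2 ww.1).
have sK : involutive s.
  by move=> [w w']; congr pair; apply/ffunP => i; rewrite !ffunE; case: (D i).
rewrite (reindex_inj (inv_inj sK)) /=.
rewrite -(pair_bigA _ (fun w w' => prodpmf mu (merge D w w') *
  prodpmf mu (merge D w' w) * f (merge D w w')))/=.
apply: eq_bigr => w _; rewrite /Ex mulr_sumr; apply: eq_bigr => w' _.
rewrite mulrA; congr (_ * _); rewrite /prodpmf -!big_split /=.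
by apply: eq_bigr => i _; rewrite !ffunE; case: (D i) => //; rewrite mulrC.
Qed.

End ProductExpectation.

(** * Exponential moments of bilinear forms in independent variables *)

Section Chaos.
Context {R : realType}.

Lemma exchange_Ex (C D : finType) (mu : C -> R) (nu : D -> R) f :
  Ex mu (fun c => Ex nu (f c)) = Ex nu (fun d => Ex mu (f^~ d)).
Proof.
rewrite /Ex; under eq_bigr do rewrite mulr_sumr.
rewrite exchange_big; apply: eq_bigr => d _; rewrite mulr_sumr.
by apply: eq_bigr => c _; rewrite mulrCA.
Qed.

Context {I C : finType} (mu : I -> C -> R) (y z : C -> R) (s : I -> R).
Hypothesis mu_pmf : forall i, is_pmf (mu i).
Hypothesis y01 : forall c, 0 <= y c <= 1.
Hypothesis z01 : forall c, 0 <= z c <= 1.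
Hypothesis Ey : forall i, Ex (mu i) y = s i.
Hypothesis Ez : forall i, Ex (mu i) z = s i.

Let P := prodpmf mu.

Let P_pmf : is_pmf P. Proof. exact: prodpmf_is_pmf. Qed.

Let s01 i : 0 <= s i <= 1.
Proof.
rewrite -Ey Ex_ge0//= => [|c]; last by case/andP: (y01 c).
by rewrite -(Ex_cst 1 (mu_pmf i)) le_Ex// => c; case/andP: (y01 c).
Qed.

(** For fixed [w'] the form is a sum over the independent coordinates of [w]. Integrating these out
    costs a variance term that is again linear in the [z (w' i)], so the same one-variable bound
    then integrates out [w']. *)
Lemma Ex_decoupled_mgf (G : I -> I -> R) (M l : R) :
  (forall k i, 0 <= G k i) -> 0 <= M ->
  (forall k, \sum_i G k i <= M) -> (forall i, \sum_k G k i <= M) ->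
  `|l| * M <= 4^-1 ->
  Ex P (fun w' => Ex P (fun w =>
    expR (l * \sum_k \sum_i G k i * (y (w k) * z (w' i) - s k * s i)))) <=
  expR (7 * l ^+ 2 * M ^+ 2 * \sum_i s i ^+ 2).
Proof.
move=> G0 M0 Grow Gcol lM.
pose h i := \sum_k G k i * s k.
have h0 i : 0 <= h i.
  by apply: sumr_ge0 => k _; rewrite mulr_ge0//; case/andP: (s01 k).
have hM i : h i <= M.
  apply: le_trans (Gcol i); apply: ler_sum => k _.
  by rewrite ler_piMr//; case/andP: (s01 k).
(* Schur's test: [s k * s i] is at most the mean of the two squares, and the rows and columns of [G]
   sum to at most [M]. *)
have hs : \sum_i h i * s i <= M * \sum_i s i ^+ 2.
  have -> : \sum_i h i * s i = \sum_i \sum_k G k i * (s k * s i).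
    by apply: eq_bigr => i _; rewrite mulr_suml; apply: eq_bigr => k _; rewrite mulrA.
  have le1 : \sum_i \sum_k G k i * (s k * s i) <=
     \sum_i \sum_k (G k i * (2^-1 * s i ^+ 2) + G k i * (2^-1 * s k ^+ 2)).
    apply: ler_sum => i _; apply: ler_sum => k _; rewrite -mulrDr ler_wpM2l//.
    have := sqr_ge0 (s k - s i); rewrite !expr2; lra.
  apply: (le_trans le1).
  have -> : M * \sum_i s i ^+ 2 =
     M * (2^-1 * \sum_i s i ^+ 2) + M * (2^-1 * \sum_i s i ^+ 2).
    by field.
  under eq_bigr do rewrite big_split /=; rewrite big_split /= exchange_big /=.
  rewrite [X in _ + X]exchange_big /= exchange_big /=.
  rewrite !mulr_sumr; apply: lerD; apply: ler_sum => i _; rewrite -mulr_suml;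
    by apply: ler_wpM2r => //; rewrite mulr_ge0 ?sqr_ge0.
have lM2 : l ^+ 2 * M <= 4^-1 * `|l|.
  by rewrite -real_normK ?num_real// expr2 -mulrA mulrC ler_wpM2r.
(* The coefficient of [z (w' i) - s i] once [w] is integrated out: [l] is the original one,
   [2 * l ^+ 2 * M] comes from the variance term. *)
pose a i := (l + 2 * l ^+ 2 * M) * h i.
have lb : `|l + 2 * l ^+ 2 * M| <= 3 / 2 * `|l|.
  apply: le_trans (ler_normD _ _) _.
  have -> : `|2 * l ^+ 2 * M| = 2 * (l ^+ 2 * M).
    by rewrite -mulrA ger0_norm //; nonneg.
  lra.
have inner w' : Ex P (fun w =>
    expR (l * \sum_k \sum_i G k i * (y (w k) * z (w' i) - s k * s i))) <=
    expR (\sum_i (a i * (z (w' i) - s i) + 2 * l ^+ 2 * M * h i * s i)).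
  pose e k := \sum_i G k i * z (w' i).
  have e0 k : 0 <= e k.
    by apply: sumr_ge0 => i _; rewrite mulr_ge0//; case/andP: (z01 (w' i)).
  have eM k : e k <= M.
    apply: le_trans (Grow k); apply: ler_sum => i _.
    by rewrite ler_piMr//; case/andP: (z01 (w' i)).
  have hz : \sum_k e k * s k = \sum_i h i * z (w' i).
    rewrite /e /h; under eq_bigr do rewrite mulr_suml.
    rewrite exchange_big; apply: eq_bigr => i _; rewrite mulr_suml.
    by apply: eq_bigr => k _; rewrite mulrAC.
  (* The split is [y z - s_k s_i = (y - s_k) z + s_k (z - s_i)]; [b] collects the second part, which
     does not involve [w]. *)
  pose b := \sum_i l * h i * (z (w' i) - s i).
  rewrite (@eq_Ex _ _ _ _ (fun w : {ffun I -> C} =>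
      expR b * expR (\sum_k l * e k * (y (w k) - s k)))) => [|w]; last first.
    rewrite -expRD; congr expR; rewrite /b.
    have -> : \sum_i l * h i * (z (w' i) - s i) =
      \sum_k \sum_i l * (G k i * s k * (z (w' i) - s i)).
      rewrite exchange_big; apply: eq_bigr => i _; rewrite /h.
      by rewrite mulr_sumr mulr_suml; apply: eq_bigr => k _; rewrite !mulrA.
    rewrite -big_split mulr_sumr; apply: eq_bigr => k _ /=.
    rewrite /e !mulr_sumr mulr_suml -big_split; apply: eq_bigr => i _ /=; ring.
  rewrite ExZ (Ex_prodpmf_expR_sum _ (fun k c => l * e k * (y c - s k))).
  have -> : \sum_i (a i * (z (w' i) - s i) + 2 * l ^+ 2 * M * h i * s i) =
     b + 2 * l ^+ 2 * M * \sum_k e k * s k.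
    rewrite hz /b mulr_sumr -big_split; apply: eq_bigr => i _ /=; rewrite /a; ring.
  rewrite expRD ler_pM2l ?expR_gt0//.
  rewrite mulr_sumr expR_sum; apply: ler_prod => k _.
  rewrite Ex_ge0 /=; [|exact: mu_pmf|by move=> c; exact: expR_ge0].
  have lek : `|l * e k| <= 2^-1.
    rewrite normrM (ger0_norm (e0 k)).
    have : `|l| * e k <= `|l| * M by rewrite ler_wpM2l.
    by move=> ?; lra.
  apply: le_trans (Ex_expR_centered (mu_pmf k) y01 (Ey k) lek) _.
  rewrite ler_expR; have [sk0 _] := andP (s01 k).
  (* That is, [e k ^+ 2 <= M * e k], which makes the variance term linear in [e]. *)
  have : 0 <= (2 * l ^+ 2) * (s k * (e k * (M - e k))).
    by nonneg.
  rewrite !expr2; nra.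
apply: (le_trans (le_Ex P_pmf inner)).
rewrite (Ex_prodpmf_expR_sum _
  (fun i c => a i * (z c - s i) + 2 * l ^+ 2 * M * h i * s i)).
have aM i : a i ^+ 2 <= 9 / 4 * l ^+ 2 * M * h i.
  rewrite /a exprMn.
  have l1 : (l + 2 * l ^+ 2 * M) ^+ 2 <= 9 / 4 * l ^+ 2.
    have -> : 9 / 4 * l ^+ 2 = (3 / 2 * `|l|) ^+ 2.
      by rewrite exprMn real_normK ?num_real//; congr (_ * _); lra.
    rewrite -[leLHS]real_normK ?num_real//.
    by rewrite lerXn2r ?nnegrE//; nonneg.
  rewrite -[leRHS]mulrA; apply: ler_pM => //; rewrite ?sqr_ge0//.
  by rewrite expr2 ler_wpM2r.
have step i : Ex (mu i)
    (fun c => expR (a i * (z c - s i) + 2 * l ^+ 2 * M * h i * s i)) <=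
    expR (7 * l ^+ 2 * M * (h i * s i)).
  rewrite (@eq_Ex _ _ _ _ (fun c =>
    expR (2 * l ^+ 2 * M * h i * s i) * expR (a i * (z c - s i)))) => [|c];
    last by rewrite -expRD addrC.
  rewrite ExZ; have ai : `|a i| <= 2^-1.
    rewrite normrM (ger0_norm (h0 i)).
    have := ler_pM (normr_ge0 _) (h0 i) lb (hM i); lra.
  apply: le_trans (ler_wpM2l (expR_ge0 _) (Ex_expR_centered (mu_pmf i) z01 (Ez i) ai)) _.
  rewrite -expRD ler_expR; have [si0 _] := andP (s01 i).
  have := ler_wpM2r si0 (aM i).
  have : 0 <= l ^+ 2 * M * h i * s i by nonneg.
  lra.
apply: (@le_trans _ _ (\prod_i expR (7 * l ^+ 2 * M * (h i * s i)))).
  by apply: ler_prod => i _; rewrite step andbT Ex_ge0.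
rewrite -expR_sum -mulr_sumr ler_expR.
have -> : 7 * l ^+ 2 * M ^+ 2 * \sum_i s i ^+ 2 =
  7 * l ^+ 2 * M * (M * \sum_i s i ^+ 2) by ring.
by rewrite ler_wpM2l//; nonneg.
Qed.

(* Decoupling: the indicator of [k != i] is four times the probability that a
   uniform random subset [d] contains [k] but not [i], and Jensen's inequality
   moves this average over [d] out of the exponential. *)
Lemma Ex_offdiag_mgf (H : I -> I -> R) (M l : R) :
  (forall k i, 0 <= H k i) -> 0 <= M ->
  (forall k, \sum_i H k i <= M) -> (forall i, \sum_k H k i <= M) ->
  `|l| * M <= 16^-1 ->
  Ex P (fun w => expR (l * \sum_k \sum_(i | i != k)
    H k i * (y (w k) * z (w i) - s k * s i))) <=
  expR (112 * l ^+ 2 * M ^+ 2 * \sum_i s i ^+ 2).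
Proof.
move=> H0 M0 Hrow Hcol lM.
pose half := fun _ : bool => 2^-1 : R.
have half_pmf : forall _ : I, is_pmf half.
  move=> _; split=> [b|]; first by rewrite /half invr_ge0.
  by rewrite big_bool /half /=; lra.
pose Pd := prodpmf (fun _ : I => half).
have Pd_pmf : is_pmf Pd by exact: prodpmf_is_pmf.
pose G (d : {ffun I -> bool}) k i := (d k)%:R * (~~ d i)%:R * H k i.
have EG k i : Ex Pd (fun d => G d k i) = (i != k)%:R * (4^-1 * H k i).
  rewrite (@eq_Ex _ _ _ _
    (fun d : {ffun I -> bool} => H k i * ((d k)%:R * (~~ d i)%:R)));
    last by move=> d; rewrite mulrC.
  rewrite ExZ; have [->|ik] := eqVneq i k.
    rewrite (@eq_Ex _ _ _ _ (fun=> 0)) => [|d]; last by case: (d k); rewrite ?mulr0 ?mul0r.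
    by rewrite Ex_cst// mulr0 mul0r.
  rewrite (Ex_prodpmf_proj2 (fun b : bool => b%:R) (fun b => (~~ b)%:R) half_pmf);
    last by rewrite eq_sym.
  by rewrite /Ex !big_bool /half /=; lra.
pose X d (w w' : {ffun I -> C}) :=
  (4 * l) * \sum_k \sum_i G d k i * (y (w k) * z (w' i) - s k * s i).
have EX (w : {ffun I -> C}) : l * (\sum_k \sum_(i | i != k)
    H k i * (y (w k) * z (w i) - s k * s i)) = Ex Pd (fun d => X d w w).
  rewrite /X ExZ Ex_sum [4 * l]mulrC -mulrA; congr (_ * _).
  rewrite mulr_sumr; apply: eq_bigr => k _; rewrite Ex_sum mulr_sumr big_mkcond.
  apply: eq_bigr => i _.
  rewrite (@eq_Ex _ _ _ _ (fun d => (y (w k) * z (w i) - s k * s i) * G d k i));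
    last by move=> d; rewrite mulrC.
  by rewrite ExZ EG; case: (i != k) => /=; lra.
apply: (@le_trans _ _ (Ex P (fun w => Ex Pd (fun d => expR (X d w w))))).
  by apply: le_Ex => // w; rewrite EX; exact: expR_Ex_le.
rewrite exchange_Ex -[leRHS](Ex_cst _ Pd_pmf); apply: le_Ex => // d.
(* For fixed [d], the form with kernel [G d] reads its first argument only inside [d] and its second
   only outside, so the two may be taken from independent copies. *)
rewrite -(Ex_merge d _ mu_pmf) exchange_Ex.
rewrite (@eq_Ex _ _ _ _ (fun w' => Ex P (fun w => expR (X d w w')))); last first.
  move=> w'; apply: eq_Ex => w; congr expR; congr (_ * _).
  apply: eq_bigr => k _; apply: eq_bigr => i _; rewrite /G !ffunE.
  by case: (d k); case: (d i) => /=; rewrite ?mul0r ?mulr0 ?mul0r.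
have Gle k i : 0 <= G d k i <= H k i.
  by rewrite /G; case: (d k); case: (d i); rewrite /= ?(mulr0, mul0r, mul1r) lexx ?H0.
apply: le_trans (@Ex_decoupled_mgf (G d) M (4 * l) _ M0 _ _ _) _ => //.
- by move=> k i; case/andP: (Gle k i).
- by move=> k; apply: le_trans (Hrow k); apply: ler_sum => i _; case/andP: (Gle k i).
- by move=> i; apply: le_trans (Hcol i); apply: ler_sum => k _; case/andP: (Gle k i).
- by rewrite normrM ger0_norm//; lra.
by rewrite ler_expR exprMn; lra.
Qed.

End Chaos.

(** * Tail bounds for the diagonal and off-diagonal sums *)

Section Tails.
Context {R : realType}.
Context {I C : finType} (mu : I -> C -> R) (y z : C -> R) (s : I -> R).
Hypothesis mu_pmf : forall i, is_pmf (mu i).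
Hypothesis y01 : forall c, 0 <= y c <= 1.
Hypothesis z01 : forall c, 0 <= z c <= 1.
Hypothesis Ey : forall i, Ex (mu i) y = s i.
Hypothesis Ez : forall i, Ex (mu i) z = s i.

Let P := prodpmf mu.

Let P_pmf : is_pmf P. Proof. exact: prodpmf_is_pmf. Qed.

(** Chernoff's bound at [l = (2 * K)^-1], where [l * h k <= 2^-1]. Each coordinate then adds at most
    [2 * l * h k * s k] to the exponent, which the doubled mean in the threshold cancels, and
    [l * (16 * K * L) = 8 * L] remains. *)
Lemma diag_tail (h : I -> R) (K L : R) :
  (forall k, 0 <= h k <= K) -> 0 < K ->
  Ex P (fun w => (2 * (\sum_k h k * s k) + 16 * K * L
                    <= \sum_k h k * y (w k))%R%:R) <= expR (- (8 * L)).
Proof.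
move=> hK K0; pose l := (2 * K)^-1.
have l0 : 0 < l by rewrite invr_gt0 mulr_gt0.
apply: (le_trans (Ex_markov _ _ P_pmf (ltW l0))).
rewrite (@eq_Ex _ _ _ _ (fun w : {ffun I -> C} =>
    expR (\sum_k l * h k * y (w k)))) => [|w]; last first.
  by rewrite mulr_sumr; congr expR; apply: eq_bigr => k _; rewrite mulrA.
rewrite (Ex_prodpmf_expR_sum _ (fun k c => l * h k * y c)).
have step k : Ex (mu k) (fun c => expR (l * h k * y c)) <=
    expR (2 * l * (h k * s k)).
  have [hk0 hkK] := andP (hK k).
  have lh : l * h k <= 2^-1.
    have -> : 2^-1 = l * K by rewrite /l invfM -mulrA mulVf ?mulr1// gt_eqF.
    by rewrite ler_pM2l.
  have lh0 : 0 <= l * h k by rewrite mulr_ge0// ltW.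
  rewrite (@eq_Ex _ _ _ _ (fun c =>
    expR (l * h k * s k) * expR (l * h k * (y c - s k)))) => [|c]; last first.
    by rewrite -expRD -mulrDr addrC subrK.
  have lhn : `|l * h k| <= 2^-1 by rewrite ger0_norm.
  rewrite ExZ.
  apply: le_trans (ler_wpM2l (expR_ge0 _)
    (Ex_expR_centered (mu_pmf k) y01 (Ey k) lhn)) _.
  rewrite -expRD ler_expR.
  have sk0 : 0 <= s k by rewrite -Ey Ex_ge0// => c; case/andP: (y01 c).
  have : 0 <= (l * h k) * (s k * (2^-1 - l * h k)) by nonneg.
  rewrite !expr2; nra.
apply: (@le_trans _ _ (expR (- (l * (2 * (\sum_k h k * s k) + 16 * K * L))) *
    \prod_k expR (2 * l * (h k * s k)))).
  rewrite ler_wpM2l ?expR_ge0//.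
  by apply: ler_prod => k _; rewrite step andbT Ex_ge0.
rewrite -expR_sum -mulr_sumr -expRD ler_expR.
have -> : 8 * L = l * (16 * K * L) by rewrite /l; field; rewrite gt_eqF.
lra.
Qed.

(** Supplies the Chernoff parameter [x = l * M], with [a] and [b] the square roots of [sigma] and
    [L]. The witness [b / (a + 16 * b)] is of the order of the smaller of [b / a] and 1. *)
Let L_scale (a b : R) : 0 <= a -> 0 <= b ->
  exists x, [/\ 0 <= x, 16 * x <= 1, x * a <= b & b <= 16 * (x * (a + b))].
Proof.
move=> a0; rewrite le_eqVlt => /predU1P[<-|b0].
  by exists 0; split; rewrite ?mulr0 ?mul0r ?mulr0.
have ab : 0 < a + 16 * b by rewrite ltr_wpDl// mulr_gt0.
exists (b / (a + 16 * b)); split.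
- by rewrite divr_ge0// ltW.
- by rewrite mulrA ler_pdivrMr// mul1r lerDr.
- by rewrite mulrAC ler_pdivrMr// ler_pM2l// lerDl mulr_ge0// ltW.
rewrite mulrAC mulrA ler_pdivlMr// mulrCA ler_pM2l//; lra.
Qed.

(** Chernoff's bound is applied to the form and to its negative, whence the factor 2. *)
Lemma offdiag_tail (H : I -> I -> R) (M L : R) :
  (forall k i, 0 <= H k i) -> 0 < M -> 0 <= L ->
  (forall k, \sum_i H k i <= M) -> (forall i, \sum_k H k i <= M) ->
  Ex P (fun w => (1920 * M * (Num.sqrt ((\sum_i s i ^+ 2) * L) + L) <=
    `|\sum_k \sum_(i | i != k) H k i * (y (w k) * z (w i) - s k * s i)|)%R%:R)
  <= 2 * expR (- (8 * L)).
Proof.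
move=> H0 M0 L0 Hrow Hcol.
pose Z (w : {ffun I -> C}) :=
  \sum_k \sum_(i | i != k) H k i * (y (w k) * z (w i) - s k * s i).
set sigma := \sum_i s i ^+ 2; set t := 1920 * M * _.
have sigma0 : 0 <= sigma by apply: sumr_ge0 => i _; exact: sqr_ge0.
have [x [x0 x16 xa xb]] := L_scale (sqrtr_ge0 sigma) (sqrtr_ge0 L).
have [l [l0 lM]] : exists l, 0 <= l /\ l * M = x.
  by exists (x / M); rewrite divr_ge0 ?(ltW M0)// divfK// gt_eqF.
have bb : Num.sqrt L ^+ 2 = L by exact: sqr_sqrtr.
have aa : Num.sqrt sigma ^+ 2 = sigma by exact: sqr_sqrtr.
(* Here [l * t] is at least [120 * L] and the quadratic term is at most [112 * L]; this is the
   origin of [1920 = 16 * (112 + 8)]. *)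
have key : - (l * t) + 112 * l ^+ 2 * M ^+ 2 * sigma <= - (8 * L).
  have -> : l * t = 1920 * (Num.sqrt L * (x * (Num.sqrt sigma + Num.sqrt L))).
    rewrite /t sqrtrM// -lM -[X in _ + X]bb; ring.
  have -> : 112 * l ^+ 2 * M ^+ 2 * sigma = 112 * (x * Num.sqrt sigma) ^+ 2.
    by rewrite [in RHS]exprMn aa -lM; ring.
  have h1 : (x * Num.sqrt sigma) ^+ 2 <= L.
    by rewrite -[leRHS]bb lerXn2r ?nnegrE ?sqrtr_ge0//; nonneg; exact: sqrtr_ge0.
  have h2 := ler_wpM2l (sqrtr_ge0 L) xb.
  rewrite -expr2 bb in h2; lra.
have one (e : R) : `|e| = 1 -> Ex P (fun w => (t <= e * Z w)%R%:R) <= expR (- (8 * L)).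
  move=> e1.
  apply: (le_trans (Ex_markov _ _ P_pmf l0)).
  rewrite (@eq_Ex _ _ _ _ (fun w => expR ((l * e) * Z w))) => [|w]; last first.
    by rewrite mulrA.
  have le16 : `|l * e| * M <= 16^-1.
    by rewrite normrM e1 mulr1 ger0_norm// lM; lra.
  apply: le_trans (ler_wpM2l (expR_ge0 _)
    (Ex_offdiag_mgf mu_pmf y01 z01 Ey Ez H0 (ltW M0) Hrow Hcol le16)) _.
  have -> : (l * e) ^+ 2 = l ^+ 2.
    by rewrite exprMn -[e ^+ 2]real_normK ?num_real// e1 expr1n mulr1.
  by rewrite -expRD ler_expR.
have -> : 2 * expR (- (8 * L)) = expR (- (8 * L)) + expR (- (8 * L)) by lra.
apply: (@le_trans _ _ (Ex P (fun w => (t <= 1 * Z w)%R%:R + (t <= -1 * Z w)%R%:R))).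
  apply: le_Ex => // w; rewrite mul1r mulN1r ler_normr.
  by case: (t <= Z w); case: (t <= - Z w); rewrite /= ?addr0 ?add0r// lerDl.
by rewrite ExD lerD// one// ?normrN normr1.
Qed.

End Tails.

(** * Operator norm, square roots and the Frobenius norm *)

Lemma sum_pairE (V : nmodType) (I J : finType) (F : I * J -> V) :
  \sum_z F z = \sum_i \sum_j F (i, j).
Proof. by rewrite pair_bigA; apply: eq_bigr => -[]. Qed.

Section OperatorNorm.
Context {R : realType}.

Lemma sum_delta_sqr n (k : 'I_n) :
  \sum_i (delta_mx k 0 : 'cV[R]_n) i 0 ^+ 2 = 1.
Proof.
rewrite (bigD1 k)//= mxE !eqxx expr1n big1 ?addr0// => i /negPf ik.
by rewrite mxE ik expr0n.
Qed.

Lemma l2sphere_sum n (x : 'cV[R]_n) : l2sphere n x -> \sum_i x i 0 ^+ 2 = 1.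
Proof.
rewrite /l2sphere /l2norm /= => x1.
rewrite -[LHS]sqr_sqrtr ?x1 ?expr1n//.
by apply: sumr_ge0 => i _; exact: sqr_ge0.
Qed.

Lemma l2sphere_le1 n (x : 'cV[R]_n) i : l2sphere n x -> `|x i 0| <= 1.
Proof.
move=> /l2sphere_sum x1; rewrite -(@expr_le1 _ 2)// real_normK ?num_real//.
rewrite -x1 (bigD1 i)//= lerDl; apply: sumr_ge0 => j _; exact: sqr_ge0.
Qed.

Lemma opnorm_ub m n (M : 'M[R]_(m, n)) x :
  l2sphere n x -> l2norm (M *m x) <= opnorm M.
Proof.
move=> x1; apply: ub_le_sup; last by exists x.
exists (Num.sqrt (\sum_i (\sum_j `|M i j|) ^+ 2)) => _ [y y1 <-].
rewrite /l2norm ler_sqrt; last by apply: sumr_ge0 => i _; exact: sqr_ge0.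
apply: ler_sum => i _; rewrite -[leLHS]real_normK ?num_real// lerXn2r ?nnegrE//.
  exact: sumr_ge0.
rewrite mxE; apply: le_trans (ler_norm_sum _ _ _) _; apply: ler_sum => j _.
by rewrite normrM ler_piMr// l2sphere_le1.
Qed.

Lemma opnorm_sum_le m n (M : 'M[R]_(m, n)) (x : 'cV[R]_n) :
  \sum_i (M *m x) i 0 ^+ 2 <= opnorm M ^+ 2 * \sum_i x i 0 ^+ 2.
Proof.
set N := \sum_i x i 0 ^+ 2.
have N0 : 0 <= N by apply: sumr_ge0 => i _; exact: sqr_ge0.
have [N_eq0|N_neq0] := eqVneq N 0.
  have -> : x = 0.
    apply/matrixP => i j; rewrite (ord1 j) mxE; apply/eqP; rewrite -sqrf_eq0.
    have /psumr_eq0P/(_ N_eq0)/(_ i isT)-> // : forall i, true -> 0 <= x i 0 ^+ 2.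
    by move=> ? _; exact: sqr_ge0.
  rewrite mulmx0 big1 ?N_eq0 ?mulr0// => i _.
  by rewrite mxE expr0n.
have Ngt0 : 0 < N by rewrite lt_def N_neq0.
pose t := (Num.sqrt N)^-1.
have t2 : t ^+ 2 = N^-1 by rewrite exprVn sqr_sqrtr.
have sx : l2sphere n (t *: x).
  rewrite /l2sphere /l2norm /=.
  rewrite (_ : \sum_i _ = 1) ?sqrtr1//.
  under eq_bigr do rewrite mxE exprMn t2.
  by rewrite -mulr_sumr mulVf.
have := opnorm_ub M sx; rewrite -scalemxAr => h.
have h2 : l2norm (t *: (M *m x)) ^+ 2 <= opnorm M ^+ 2.
  by rewrite lerXn2r ?nnegrE ?sqrtr_ge0// (le_trans _ h)// sqrtr_ge0.
move: h2; rewrite /l2norm sqr_sqrtr; last by apply: sumr_ge0 => i _; exact: sqr_ge0.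
under eq_bigr do rewrite mxE exprMn t2.
by rewrite -mulr_sumr mulrC ler_pdivrMr.
Qed.

Lemma opnorm_spd_gt0 n (A : 'M[R]_n) : (0 < n)%N -> spd A -> 0 < opnorm A.
Proof.
case: n A => // n A _ [_ A0].
pose e : 'cV[R]_n.+1 := delta_mx 0 0.
have se : \sum_i e i 0 ^+ 2 = 1 by exact: sum_delta_sqr.
have /opnorm_ub opA : l2sphere n.+1 e by rewrite /l2sphere /l2norm /= se sqrtr1.
rewrite lt_def (le_trans _ (opA _ A)) ?sqrtr_ge0// andbT.
apply/negP => /eqP A_eq0; have := opnorm_sum_le A e.
rewrite A_eq0 expr0n /= mul0r => Ae.
have Ae0 i : (A *m e) i 0 = 0.
  apply/eqP; rewrite -sqrf_eq0 eq_le sqr_ge0 andbT.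
  apply: le_trans Ae; rewrite (bigD1 i)//= lerDl.
  by apply: sumr_ge0 => j _; exact: sqr_ge0.
have /A0 : e != 0.
  apply/eqP => /matrixP/(_ 0 0)/eqP; rewrite !mxE !eqxx /=.
  by rewrite oner_eq0.
rewrite -mulmxA mxE big1 ?ltxx// => j _.
by rewrite Ae0 mulr0.
Qed.

End OperatorNorm.

(** * Square roots of positive definite matrices *)

Section SquareRoot.
Context {R : realType} {n : nat} (A S : 'M[R]_n).
Hypothesis n_gt0 : (0 < n)%N.
Hypothesis spdA : spd A.
Hypothesis sqrtA : is_spd_sqrt A S.

Let c_gt0 : 0 < opnorm A. Proof. exact: opnorm_spd_gt0. Qed.

Lemma spd_sqrt_sym i j : S i j = S j i.
Proof. by have [[ST _] _] := sqrtA; rewrite -[in LHS]ST mxE. Qed.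

Lemma spd_sym i j : A i j = A j i.
Proof. by have [AT _] := spdA; rewrite -[in LHS]AT mxE. Qed.

Lemma spd_sqrt_col_dot i j : \sum_k S k i * S k j = A i j.
Proof.
have [_ <-] := sqrtA; rewrite mxE; apply: eq_bigr => k _.
by rewrite spd_sqrt_sym.
Qed.

(** The left side is the inner product of [x] and [A *m x]. In place of Cauchy-Schwarz, [a * b <= c
    / 2 * a ^+ 2 + (2 * c)^-1 * b ^+ 2] with [c = opnorm A] is summed over the coordinates; each
    half is at most [c / 2] times the squared norm of [x]. *)
Lemma spd_sqrt_sum_le (x : 'cV[R]_n) :
  \sum_i (S *m x) i 0 ^+ 2 <= opnorm A * \sum_i x i 0 ^+ 2.
Proof.
have -> : \sum_i (S *m x) i 0 ^+ 2 = \sum_i x i 0 * (A *m x) i 0.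
  have [[ST _] SS] := sqrtA.
  have : (S *m x)^T *m (S *m x) = x^T *m (A *m x).
    by rewrite trmx_mul ST -mulmxA [S *m (S *m x)]mulmxA SS.
  move=> /matrixP/(_ 0 0); rewrite !mxE => h.
  under eq_bigr do rewrite expr2.
  transitivity (\sum_j (S *m x)^T 0 j * (S *m x) j 0).
    by apply: eq_bigr => j _; rewrite [(S *m x)^T _ _]mxE.
  by rewrite h; apply: eq_bigr => j _; rewrite mxE.
apply: (@le_trans _ _ (\sum_i (opnorm A / 2 * x i 0 ^+ 2 +
    (2 * opnorm A)^-1 * (A *m x) i 0 ^+ 2))).
  apply: ler_sum => i _; set a := x i 0; set b := (A *m x) i 0.
  have -> : opnorm A / 2 * a ^+ 2 + (2 * opnorm A)^-1 * b ^+ 2 =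
    a * b + (2 * opnorm A)^-1 * (opnorm A * a - b) ^+ 2.
    by field; rewrite gt_eqF.
  by rewrite lerDl mulr_ge0 ?sqr_ge0// invr_ge0 mulr_ge0// ltW.
rewrite big_split /= -!mulr_sumr.
have : (2 * opnorm A)^-1 * \sum_i (A *m x) i 0 ^+ 2 <=
   (2 * opnorm A)^-1 * (opnorm A ^+ 2 * \sum_i x i 0 ^+ 2).
  by rewrite ler_pM2l ?opnorm_sum_le// invr_gt0 mulr_gt0.
have -> : (2 * opnorm A)^-1 * (opnorm A ^+ 2 * \sum_i x i 0 ^+ 2) =
  opnorm A / 2 * \sum_i x i 0 ^+ 2 by field; rewrite gt_eqF.
lra.
Qed.

Lemma spd_diag_gt0 k : 0 < A k k.
Proof.
have [_ /(_ (delta_mx k 0))] := spdA.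
rewrite -mulmxA -colE trmx_delta -rowE !mxE; apply.
by apply/eqP => /matrixP/(_ k 0)/eqP; rewrite !mxE !eqxx oner_eq0.
Qed.

Lemma spd_diag_le_opnorm k : A k k <= opnorm A.
Proof.
have := spd_sqrt_sum_le (delta_mx k 0); rewrite -colE sum_delta_sqr.
rewrite mulr1 -spd_sqrt_col_dot; apply: le_trans.
by under [leRHS]eq_bigr do rewrite mxE expr2.
Qed.

(** Column [k] of [A] is [S] applied to column [k] of [S], and the latter has squared norm
    [A k k]. *)
Lemma spd_row_sum_le k : \sum_l A k l ^+ 2 <= opnorm A * A k k.
Proof.
have := spd_sqrt_sum_le (col k S).
have -> : \sum_i col k S i 0 ^+ 2 = A k k.
  by rewrite -spd_sqrt_col_dot; apply: eq_bigr => i _; rewrite mxE expr2.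
apply: le_trans; apply: ler_sum => l _.
have [_ SS] := sqrtA.
by rewrite colE mulmxA SS -colE mxE spd_sym.
Qed.

Definition fro2 {p q} (M : 'M[R]_(p, q)) := \sum_i \sum_j M i j ^+ 2.

Lemma fro2_tr p q (M : 'M[R]_(p, q)) : fro2 M^T = fro2 M.
Proof.
rewrite /fro2 exchange_big; apply: eq_bigr => i _; apply: eq_bigr => j _.
by rewrite mxE.
Qed.

Lemma fro2_spd_sqrt_mul_le p (M : 'M[R]_(n, p)) :
  fro2 (S *m M) <= opnorm A * fro2 M.
Proof.
rewrite -(fro2_tr (S *m M)) -(fro2_tr M) /fro2 mulr_sumr; apply: ler_sum => j _.
have trE q (X : 'M[R]_(q, p)) :
    \sum_i X^T j i ^+ 2 = \sum_i col j X i 0 ^+ 2.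
  by apply: eq_bigr => i _; rewrite !mxE.
rewrite !trE (colE _ (S *m M)) -mulmxA -colE.
exact: spd_sqrt_sum_le.
Qed.

(** The form [T] of the proof idea, with [A] for [B_0]: the bilinear form of the Kronecker square of
    [A]. *)
Definition pairform (X Y : 'I_n * 'I_n -> R) :=
  \sum_z \sum_z' A z.1 z'.1 * A z.2 z'.2 * X z * Y z'.

(** The entries of [S *m M *m S], where [M] is the transpose of [X] read as a matrix. *)
Let N (X : 'I_n * 'I_n -> R) a b := \sum_z X z * (S a z.2 * S b z.1).

(** Each entry of [A] is a dot product of columns of [S], which identifies the form with a Frobenius
    inner product. *)
Lemma pairformE X Y : \sum_a \sum_b N X a b * N Y a b = pairform X Y.
Proof.
rewrite /pairform.
transitivity (\sum_a \sum_b \sum_z \sum_z'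
  (S b z.1 * S b z'.1) * ((S a z.2 * S a z'.2) * (X z * Y z'))).
  apply: eq_bigr => a _; apply: eq_bigr => b _; rewrite /N big_distrl /=.
  apply: eq_bigr => z _; rewrite big_distrr /=; apply: eq_bigr => z' _; ring.
under eq_bigr do rewrite exchange_big /=.
rewrite exchange_big; apply: eq_bigr => z _ /=.
under eq_bigr do rewrite exchange_big /=.
rewrite exchange_big; apply: eq_bigr => z' _ /=.
under eq_bigr do rewrite -mulr_suml spd_sqrt_col_dot mulrCA.
by rewrite -mulr_suml spd_sqrt_col_dot; ring.
Qed.

(** Multiplying [M] by [S] on the left, and on the right by way of a transposition, costs a factor
    [opnorm A] each time in the squared Frobenius norm. *)
Lemma pairform_le X : pairform X X <= opnorm A ^+ 2 * \sum_z X z ^+ 2.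
Proof.
pose M := \matrix_(j, i) X (i, j).
have NE : \sum_a \sum_b N X a b * N X a b = fro2 (S *m M *m S).
  apply: eq_bigr => a _; apply: eq_bigr => b _; rewrite -expr2; congr (_ ^+ 2).
  rewrite mxE /N.
  rewrite sum_pairE.
  apply: eq_bigr => i _; rewrite mxE mulr_suml; apply: eq_bigr => j _.
  by rewrite mxE (spd_sqrt_sym i b); ring.
have ME : \sum_z X z ^+ 2 = fro2 M.
  rewrite sum_pairE exchange_big.
  by apply: eq_bigr => j _; apply: eq_bigr => i _; rewrite mxE.
rewrite -pairformE NE ME expr2 -mulrA -(mulmxA S).
apply: le_trans (fro2_spd_sqrt_mul_le _) _; rewrite ler_pM2l//.
rewrite -(fro2_tr (M *m S)) trmx_mul -(fro2_tr M).
have [[-> _] _] := sqrtA; exact: fro2_spd_sqrt_mul_le.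
Qed.

(** Once absolute values are taken, the sum over pairs factors into the square of the sum bounded by
    [r]. With [rho_max] for [r], an entrywise bound on [K] becomes uniform over sparse [q]. *)
Lemma abs_pairform_sum_le (q : 'I_n -> R) (t : R)
    (K : 'I_n * 'I_n -> 'I_n * 'I_n -> R) (r : R) :
  (forall z z', `|K z z'| <= `|q z.1| * `|q z.2| * (`|q z'.1| * `|q z'.2|) * t) ->
  0 <= t -> \sum_i \sum_j `|A i j| * `|q i| * `|q j| <= r ->
  \sum_z \sum_z' A z.1 z'.1 * A z.2 z'.2 * K z z' <= r ^+ 2 * t.
Proof.
move=> Kt t0 hr.
set r0 := \sum_i _ in hr.
have r00 : 0 <= r0 by do 2![apply: sumr_ge0 => ? _]; rewrite !mulr_ge0.
apply: (@le_trans _ _ (r0 ^+ 2 * t)); last first.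
  by rewrite ler_wpM2r// lerXn2r ?nnegrE// (le_trans r00).
have -> : r0 ^+ 2 * t = \sum_z \sum_z'
  `|A z.1 z'.1 * A z.2 z'.2| *
     (`|q z.1| * `|q z.2| * (`|q z'.1| * `|q z'.2|) * t).
  pose f i i' j j' := `|A i i' * A j j'| *
     (`|q i| * `|q j| * (`|q i'| * `|q j'|) * t).
  transitivity (\sum_i \sum_j \sum_i' \sum_j' f i i' j j'); last first.
    rewrite sum_pairE; apply: eq_bigr => i _; apply: eq_bigr => j _.
    by rewrite sum_pairE.
  rewrite expr2 /r0 mulr_suml mulr_suml; apply: eq_bigr => i _.
  rewrite mulr_suml mulr_suml.
  under eq_bigr do rewrite mulr_sumr mulr_suml.
  rewrite exchange_big; apply: eq_bigr => j _ /=.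
  apply: eq_bigr => i' _.
  rewrite mulr_sumr mulr_suml; apply: eq_bigr => j' _.
  by rewrite /f normrM; ring.
apply: ler_sum => z _; apply: ler_sum => z' _.
by apply: le_trans (ler_norm _) _; rewrite normrM ler_wpM2l.
Qed.

End SquareRoot.

Lemma rho_max_ub {R : realType} n (B : 'M[R]_n) s q : sparse_sphere n s q ->
  \sum_i \sum_j `|B i j| * `|q i 0| * `|q j 0| <= rho_max s B.
Proof.
move=> sq; apply: ub_le_sup; last by exists q.
exists (\sum_i \sum_j `|B i j|) => _ [y [y1 _] <-].
apply: ler_sum => i _; apply: ler_sum => j _.
by rewrite -mulrA ler_piMr// mulr_ile1// l2sphere_le1.
Qed.

(** * The squared Frobenius norm as a sum over pairs of columns *)

Section FrobeniusNorm.
Context {R : realType} {m n : nat}.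

Definition mask_weight (u : 'I_n -> 'I_m -> bool) (q : 'cV[R]_n) (k : 'I_m)
    (z : 'I_n * 'I_n) : R :=
  (z.1 != z.2)%:R * ((u z.1 k && u z.2 k)%:R * (q z.1 0 * q z.2 0)).

(** The entry at [((a, b), (c, d))] is [\sum_k N k a c * (SA b k * SA d k)]. After squaring, the
    sums over [b] and over [d] give one factor [A0 k l] each, and those over [a] and [c] give the
    form of [B0] by [pairformE]. *)
Lemma frobnorm_Adiamond (A0 SA : 'M[R]_m) (B0 SB : 'M[R]_n) u q :
  spd A0 -> spd B0 -> is_spd_sqrt A0 SA -> is_spd_sqrt B0 SB ->
  frobnorm (Adiamond SA SB u q) ^+ 2 =
  \sum_k \sum_l A0 k l ^+ 2 *
    pairform B0 (mask_weight u q k) (mask_weight u q l).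
Proof.
move=> spdA spdB sA sB.
rewrite /frobnorm sqr_sqrtr; last first.
  by do 2![apply: sumr_ge0 => ? _]; exact: sqr_ge0.
have bij : bijective (@mxtens_index n m).
  exact: (Bijective (@mxtens_indexK n m) (@mxtens_unindexK n m)).
pose N k a c := \sum_z mask_weight u q k z * (SB a z.2 * SB c z.1).
have AE a b c d : Adiamond SA SB u q (mxtens_index (a, b)) (mxtens_index (c, d))
    = \sum_k N k a c * (SA b k * SA d k).
  rewrite /Adiamond summxE; apply: eq_bigr => k _.
  rewrite summxE /N.
  rewrite sum_pairE mulr_suml; apply: eq_bigr => i _.
  rewrite summxE mulr_suml big_mkcond; apply: eq_bigr => j _.
  rewrite /mask_weight /=; case: (i != j); last by rewrite !mul0r.
  rewrite mxE tensmxE !mxE !big_ord1 !mxE.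
  by case: (u i k); case: (u j k) => /=; ring.
rewrite (reindex (@mxtens_index n m)) /=; last exact: onW_bij.
under eq_bigr do (rewrite (reindex (@mxtens_index n m)) /=; last exact: onW_bij).
transitivity (\sum_a \sum_c \sum_b \sum_d (\sum_k N k a c * (SA b k * SA d k)) ^+ 2).
  rewrite sum_pairE.
  apply: eq_bigr => a _; rewrite [RHS]exchange_big /=.
  apply: eq_bigr => b _.
  rewrite sum_pairE.
  by apply: eq_bigr => c _; apply: eq_bigr => d _; rewrite AE.
transitivity (\sum_a \sum_c \sum_k \sum_l A0 k l ^+ 2 * (N k a c * N l a c)).
  apply: eq_bigr => a _; apply: eq_bigr => c _.
  transitivity (\sum_b \sum_d \sum_k \sum_l
    (SA d k * SA d l) * ((SA b k * SA b l) * (N k a c * N l a c))).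
    apply: eq_bigr => b _; apply: eq_bigr => d _; rewrite expr2 mulr_suml.
    by apply: eq_bigr => k _; rewrite mulr_sumr; apply: eq_bigr => l _; ring.
  under eq_bigr do rewrite exchange_big /=.
  rewrite exchange_big; apply: eq_bigr => k _ /=.
  under eq_bigr do rewrite exchange_big /=.
  rewrite exchange_big; apply: eq_bigr => l _ /=.
  under eq_bigr do rewrite -mulr_suml (spd_sqrt_col_dot sA) mulrCA.
  by rewrite -mulr_suml (spd_sqrt_col_dot sA); ring.
under [LHS]eq_bigr do rewrite exchange_big /=.
rewrite [LHS]exchange_big; apply: eq_bigr => k _ /=.
under [LHS]eq_bigr do rewrite exchange_big /=.
rewrite [LHS]exchange_big; apply: eq_bigr => l _ /=.
rewrite -(pairformE sB) mulr_sumr; apply: eq_bigr => a _.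
by rewrite mulr_sumr.
Qed.

End FrobeniusNorm.

(** * The deterministic bound *)

Section MaskBound.
Context {R : realType} {m n : nat}.
Context (A0 SA : 'M[R]_m) (B0 SB : 'M[R]_n) (p : 'I_m -> R).
Context (u : 'I_n -> 'I_m -> bool) (q : 'cV[R]_n) (s : nat) (L : R).
Hypotheses (m_gt0 : (0 < m)%N) (n_gt0 : (0 < n)%N).
Hypotheses (spdA : spd A0) (spdB : spd B0).
Hypotheses (sqrtA : is_spd_sqrt A0 SA) (sqrtB : is_spd_sqrt B0 SB).
Hypothesis p01 : forall k, 0 <= p k <= 1.
Hypothesis qs : sparse_sphere n s q.
Hypothesis L0 : 0 <= L.

Let y (z : 'I_n * 'I_n) k : R := (u z.1 k && u z.2 k)%:R.
Let alpha := opnorm A0.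
Let beta := opnorm B0.
Let a := max_diag A0.
Let psiB := psi B0 s.
Let sump2 := \sum_k p k ^+ 2.
Let X := a * sump2.
Let sigma := \sum_k (p k ^+ 2) ^+ 2.

(** This bound and the next are the only probabilistic input; neither mentions [q] or [s], and both
    hold off the bad masks. *)
Hypothesis diag_conc : forall z, z.1 != z.2 ->
  \sum_k A0 k k ^+ 2 * y z k <=
  2 * (\sum_k A0 k k ^+ 2 * p k ^+ 2) + 16 * a ^+ 2 * L.
Hypothesis offdiag_conc : forall z z', z.1 != z.2 -> z'.1 != z'.2 ->
  `|\sum_k \sum_(l | l != k) A0 k l ^+ 2 *
     (y z k * y z' l - p k ^+ 2 * p l ^+ 2)| <=
  1920 * (alpha * a) * (Num.sqrt (sigma * L) + L).
Hypothesis effective_rank :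
  psiB ^+ 2 * L <= (\sum_j A0 j j * p j ^+ 2) / alpha.

Lemma diag_le_max k : A0 k k <= a.
Proof. exact: (le_bigmax _ (fun k => A0 k k)). Qed.

Let alpha_gt0 : 0 < alpha. Proof. exact: opnorm_spd_gt0. Qed.
Let beta_gt0 : 0 < beta. Proof. exact: opnorm_spd_gt0. Qed.

Lemma max_diag_gt0 : 0 < a.
Proof.
exact: lt_le_trans (spd_diag_gt0 spdA (Ordinal m_gt0)) (diag_le_max _).
Qed.

Lemma max_diag_le_opnorm : a <= alpha.
Proof.
apply: bigmax_le => [|k _]; first exact: ltW.
exact: (spd_diag_le_opnorm m_gt0 spdA sqrtA).
Qed.

Lemma sqr_row_sum_le k : \sum_l A0 k l ^+ 2 <= alpha * a.
Proof.
apply: le_trans (spd_row_sum_le m_gt0 spdA sqrtA k) _.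
by rewrite ler_pM2l// diag_le_max.
Qed.

Let a_gt0 := max_diag_gt0.
Let a_le := max_diag_le_opnorm.
Let q1 : \sum_i q i 0 ^+ 2 = 1. Proof. by apply: l2sphere_sum; case: qs. Qed.

Let sump2_ge0 : 0 <= sump2. Proof. by apply: sumr_ge0 => k _; exact: sqr_ge0. Qed.
Let X_ge0 : 0 <= X. Proof. by rewrite mulr_ge0// ltW. Qed.
Let y01 z k : 0 <= y z k <= 1.
Proof. by rewrite /y; case: (u _ _ && _); rewrite ?lexx ?ler01. Qed.

Let rho_sum :
  \sum_i \sum_j `|B0 i j| * `|q i 0| * `|q j 0| <= psiB * beta.
Proof. by rewrite /psiB /psi divfK ?gt_eqF//; exact: rho_max_ub. Qed.

Let psi_ge0 : 0 <= psiB.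
Proof.
rewrite -(pmulr_lge0 _ beta_gt0); apply: le_trans rho_sum.
by do 2![apply: sumr_ge0 => ? _]; rewrite !mulr_ge0.
Qed.

Let e (z : 'I_n * 'I_n) : R := (z.1 != z.2)%:R * (q z.1 0 * q z.2 0).

Let e_sum : \sum_z e z ^+ 2 <= 1.
Proof.
have <- : (\sum_i q i 0 ^+ 2) * (\sum_i q i 0 ^+ 2) = 1 by rewrite q1 mulr1.
rewrite sum_pairE mulr_suml; apply: ler_sum => i _.
rewrite mulr_sumr; apply: ler_sum => j _.
rewrite /e /= -exprMn; case: (i != j); rewrite ?mul1r// mul0r expr0n.
exact: sqr_ge0.
Qed.

Let mask_weightE k z : mask_weight u q k z = y z k * e z.
Proof. by rewrite /mask_weight /y /e mulrCA. Qed.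

Let Sm := 2 * (\sum_k A0 k k ^+ 2 * p k ^+ 2) + 16 * a ^+ 2 * L.

Let Sm_ge0 : 0 <= Sm.
Proof.
have ? : 0 <= \sum_k A0 k k ^+ 2 * p k ^+ 2.
  by apply: sumr_ge0 => k _; rewrite mulr_ge0 ?sqr_ge0.
by rewrite addr_ge0// mulr_ge0// mulr_ge0// sqr_ge0.
Qed.

Let Sm_le : Sm <= 2 * (alpha * X) + 16 * a ^+ 2 * L.
Proof.
rewrite lerD2r ler_pM2l// /X /sump2 !mulr_sumr; apply: ler_sum => k _.
rewrite mulrA ler_wpM2r ?sqr_ge0// expr2.
have ak0 := ltW (spd_diag_gt0 spdA k).
apply: ler_pM => //; last exact: diag_le_max.
exact: (spd_diag_le_opnorm m_gt0 spdA sqrtA).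
Qed.

Let D := \sum_k A0 k k ^+ 2 * pairform B0 (mask_weight u q k) (mask_weight u q k).

Let diag_le_opnorm : D <= beta ^+ 2 * Sm.
Proof.
apply: (@le_trans _ _ (\sum_k A0 k k ^+ 2 *
    (beta ^+ 2 * \sum_z mask_weight u q k z ^+ 2))).
  apply: ler_sum => k _; rewrite ler_wpM2l ?sqr_ge0//.
  exact: (pairform_le n_gt0 spdB sqrtB).
have -> : \sum_k A0 k k ^+ 2 * (beta ^+ 2 * \sum_z mask_weight u q k z ^+ 2) =
    beta ^+ 2 * \sum_z e z ^+ 2 * \sum_k A0 k k ^+ 2 * y z k ^+ 2.
  rewrite mulr_sumr.
  under eq_bigr do rewrite mulrCA mulr_sumr mulr_sumr.
  rewrite exchange_big; apply: eq_bigr => z _ /=.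
  rewrite mulr_sumr mulr_sumr; apply: eq_bigr => k _.
  by rewrite mask_weightE; ring.
rewrite ler_wpM2l ?sqr_ge0// -[leRHS]mul1r.
apply: (@le_trans _ _ (\sum_z e z ^+ 2 * Sm)); last first.
  by rewrite -mulr_suml ler_wpM2r.
apply: ler_sum => z _; rewrite /e; have [|zz] := boolP (z.1 == z.2).
  by move=> _; rewrite !mul0r expr0n /= !mul0r.
rewrite ler_wpM2l ?sqr_ge0//.
apply: le_trans (diag_conc zz); apply: ler_sum => k _.
rewrite ler_wpM2l ?sqr_ge0// expr2.
by have /andP[y0 y1] := y01 z k; rewrite ler_piMr.
Qed.

(** Since [y z k * y z' k <= y z k], the upper tail for the single pair [z] already controls the
    kernel [K]. *)
Let diag_le_rho : D <= (psiB * beta) ^+ 2 * Sm.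
Proof.
pose K z z' := \sum_k A0 k k ^+ 2 * (y z k * e z * (y z' k * e z')).
have -> : D = \sum_z \sum_z' B0 z.1 z'.1 * B0 z.2 z'.2 * K z z'.
  rewrite /D /pairform /K; under eq_bigr do rewrite mulr_sumr.
  rewrite exchange_big; apply: eq_bigr => z _ /=.
  under eq_bigr do rewrite mulr_sumr.
  rewrite exchange_big; apply: eq_bigr => z' _ /=.
  by rewrite mulr_sumr; apply: eq_bigr => k _; rewrite !mask_weightE; ring.
apply: (abs_pairform_sum_le (q := fun i => q i 0)) => // z z'.
have -> : K z z' = e z * e z' * \sum_k A0 k k ^+ 2 * (y z k * y z' k).
  by rewrite /K mulr_sumr; apply: eq_bigr => k _; ring.
rewrite /e; have [|zz] := boolP (z.1 == z.2).
  by move=> _; rewrite !mul0r normr0 !mulr_ge0.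
have [|zz'] := boolP (z'.1 == z'.2).
  by move=> _; rewrite mul0r mulr0 mul0r normr0 !mulr_ge0.
rewrite !mul1r !normrM ler_wpM2l ?mulr_ge0//.
have yy0 k : 0 <= A0 k k ^+ 2 * (y z k * y z' k).
  have /andP[y0 _] := y01 z k; have /andP[y0' _] := y01 z' k.
  by nonneg.
rewrite ger0_norm; last by apply: sumr_ge0 => k _.
apply: le_trans (diag_conc zz); apply: ler_sum => k _.
rewrite ler_wpM2l ?sqr_ge0//.
have /andP[y0 _] := y01 z k; have /andP[_ y1'] := y01 z' k.
by rewrite ler_piMr.
Qed.

(** The assumed lower bound combined with [A0 j j <= a]; through it the terms in [psiB ^+ 2 * L] are
    charged to [X]. *)
Let psi_L : psiB ^+ 2 * L * alpha <= X.
Proof.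
rewrite -ler_pdivlMr//; apply: le_trans effective_rank _.
rewrite ler_pM2r ?invr_gt0// /X /sump2 mulr_sumr; apply: ler_sum => k _.
by rewrite ler_wpM2r ?sqr_ge0// diag_le_max.
Qed.

Let a_psi_L : a * alpha * (psiB ^+ 2 * L) <= alpha * X.
Proof.
apply: (@le_trans _ _ (a * X)); last by rewrite ler_wpM2r.
by rewrite -mulrA ler_pM2l// mulrC.
Qed.

Let psiL_ge0 : 0 <= psiB ^+ 2 * L.
Proof. by rewrite mulr_ge0// sqr_ge0. Qed.

Let a2_psi_L : a ^+ 2 * (psiB ^+ 2 * L) <= alpha * X.
Proof.
apply: le_trans a_psi_L; rewrite ler_wpM2r// expr2 ler_pM2l//.
Qed.

(* When [psiB <= 1] the bound by [beta ^+ 2 * Sm] would leave [L] uncompensated,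
   and when [1 < psiB] the bound by [rho_max] would multiply [X] by
   [psiB ^+ 2]. *)
Let diag_le : D <= 18 * (alpha * X) * beta ^+ 2.
Proof.
have aX : 0 <= alpha * X by rewrite mulr_ge0// ltW.
have [psi1|psi1] := leP psiB 1.
  apply: (le_trans diag_le_rho); rewrite exprMn mulrAC ler_wpM2r ?sqr_ge0//.
  apply: le_trans (ler_wpM2l (sqr_ge0 _) Sm_le) _.
  have : psiB ^+ 2 * (alpha * X) <= alpha * X by rewrite ler_piMl// expr_le1.
  have := a2_psi_L; nra.
apply: (le_trans diag_le_opnorm); rewrite mulrC ler_wpM2r ?sqr_ge0//.
apply: (le_trans Sm_le).
have : L <= psiB ^+ 2 * L by rewrite ler_peMl// expr_ge1// ltW.
move=> /(ler_wpM2l (sqr_ge0 a)); have := a2_psi_L; lra.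
Qed.

Let O := \sum_k \sum_(l | l != k) A0 k l ^+ 2 *
  pairform B0 (mask_weight u q k) (mask_weight u q l).

Let mu0 := \sum_k \sum_(l | l != k) A0 k l ^+ 2 * (p k ^+ 2 * p l ^+ 2).

(** One factor [p l ^+ 2 <= 1] is dropped, and row [k] of the squared entries sums to at most
    [alpha * a]. *)
Let mu0_le : mu0 <= alpha * X.
Proof.
rewrite /X /sump2 mulrA mulr_sumr; apply: ler_sum => k _.
apply: (@le_trans _ _ (\sum_l A0 k l ^+ 2 * p k ^+ 2)); last first.
  by rewrite -mulr_suml ler_wpM2r ?sqr_ge0// sqr_row_sum_le.
rewrite big_mkcond; apply: ler_sum => l _.
case: ifP => _; last by rewrite mulr_ge0 ?sqr_ge0.
rewrite ler_wpM2l ?sqr_ge0// ler_piMr ?sqr_ge0//.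
by have /andP[? ?] := p01 l; rewrite expr_le1.
Qed.

Let mu0_ge0 : 0 <= mu0.
Proof.
by do 2![apply: sumr_ge0 => ? _]; nonneg.
Qed.

Let t := 1920 * (alpha * a) * (Num.sqrt (sigma * L) + L).

(** The products [y z k * y z' l] are split into their mean, which is the same for all off-diagonal
    pairs and factors out as [mu0] times the form at [e], and a deviation [Q], whose entrywise bound
    [t] costs [(psiB * beta) ^+ 2]. *)
Let offdiag_le : O <= alpha * X * beta ^+ 2 + (psiB * beta) ^+ 2 * t.
Proof.
pose Q z z' := \sum_k \sum_(l | l != k) A0 k l ^+ 2 *
     (y z k * y z' l - p k ^+ 2 * p l ^+ 2).
have -> : O = mu0 * pairform B0 e e +
    \sum_z \sum_z' B0 z.1 z'.1 * B0 z.2 z'.2 * (e z * e z' * Q z z').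
  transitivity (\sum_z \sum_z' B0 z.1 z'.1 * B0 z.2 z'.2 * (e z * e z' *
     \sum_k \sum_(l | l != k) A0 k l ^+ 2 * (y z k * y z' l))).
    have -> : O = \sum_k \sum_(l | l != k) \sum_z \sum_z'
      B0 z.1 z'.1 * B0 z.2 z'.2 * (e z * e z' * (A0 k l ^+ 2 * (y z k * y z' l))).
      apply: eq_bigr => k _; apply: eq_bigr => l _; rewrite mulr_sumr.
      apply: eq_bigr => z _; rewrite mulr_sumr; apply: eq_bigr => z' _.
      by rewrite !mask_weightE; ring.
    under [LHS]eq_bigr do rewrite exchange_big /=.
    rewrite [LHS]exchange_big; apply: eq_bigr => z _ /=.
    under [LHS]eq_bigr do rewrite exchange_big /=.
    rewrite [LHS]exchange_big; apply: eq_bigr => z' _ /=.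
    rewrite !mulr_sumr; apply: eq_bigr => k _.
    by rewrite !mulr_sumr; apply: eq_bigr => l _.
  rewrite /pairform mulr_sumr -big_split; apply: eq_bigr => z _ /=.
  rewrite mulr_sumr -big_split; apply: eq_bigr => z' _ /=.
  have -> : \sum_k \sum_(l | l != k) A0 k l ^+ 2 * (y z k * y z' l) =
      mu0 + Q z z'.
    rewrite /mu0 /Q -big_split; apply: eq_bigr => k _ /=.
    rewrite -big_split; apply: eq_bigr => l _ /=; ring.
  ring.
apply: lerD.
  apply: (@le_trans _ _ (mu0 * beta ^+ 2)); last by rewrite ler_wpM2r ?sqr_ge0.
  rewrite ler_wpM2l//.
  apply: le_trans (pairform_le n_gt0 spdB sqrtB _) _.
  by rewrite ler_piMr ?sqr_ge0.
have t0 : 0 <= t.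
  apply: mulr_ge0; last by rewrite addr_ge0 ?sqrtr_ge0.
  by apply: mulr_ge0; [rewrite ler0n|apply: mulr_ge0; exact: ltW].
have w0 z z' :
    0 <= `|q z.1 0| * `|q z.2 0| * (`|q z'.1 0| * `|q z'.2 0|).
  by do 2!apply: mulr_ge0.
apply: (abs_pairform_sum_le (q := fun i => q i 0)); [|exact: t0|exact: rho_sum].
move=> z z'; rewrite /e; have [|zz] := boolP (z.1 == z.2).
  by move=> _; rewrite !mul0r normr0; exact: mulr_ge0 t0.
have [|zz'] := boolP (z'.1 == z'.2).
  by move=> _; rewrite mul0r mulr0 mul0r normr0; exact: mulr_ge0 t0.
rewrite !mul1r !normrM; apply: ler_wpM2l; first exact: w0.
exact: offdiag_conc.
Qed.

(** Squares are compared: up to [alpha * beta ^+ 2], [D + O] is at most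
    [1939 * X + 1920 * (psiB * Y) ^+ 2], and dropping the cross term bounds the square of the sum
    from below. *)
Lemma frobnorm_Adiamond_le :
  frobnorm (Adiamond SA SB u q) <=
  2000 * (Num.sqrt X +
    psiB * (a * alpha * (\sum_k p k ^+ 4) * L) `^ 4^-1) * beta * Num.sqrt alpha.
Proof.
have -> : \sum_k p k ^+ 4 = sigma.
  by apply: eq_bigr => k _; rewrite -exprM.
set v := a * alpha * sigma * L; set Y := v `^ 4^-1.
have sigma0 : 0 <= sigma by apply: sumr_ge0 => k _; exact: sqr_ge0.
have v0 : 0 <= v.
  by rewrite mulr_ge0// mulr_ge0// mulr_ge0 ?ltW.
have Y2 : Y ^+ 2 = Num.sqrt v.
  rewrite -powR12_sqrt// -powR_mulrn ?powR_ge0// -powRrM; congr (_ `^ _).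
  by field.
have Y0 : 0 <= Y by exact: powR_ge0.
have W0 : 0 <= Num.sqrt X + psiB * Y.
  by apply: addr_ge0; [exact: sqrtr_ge0|exact: mulr_ge0].
rewrite -(@ler_pXn2r _ 2) ?nnegrE; [|by []|exact: sqrtr_ge0|]; last first.
  apply: mulr_ge0; last exact: sqrtr_ge0.
  apply: mulr_ge0; last exact: ltW.
  by apply: mulr_ge0; first by rewrite ler0n.
have FE : frobnorm (Adiamond SA SB u q) ^+ 2 = D + O.
  rewrite (frobnorm_Adiamond _ _ spdA spdB sqrtA sqrtB) -big_split.
  by apply: eq_bigr => k _; rewrite (bigD1 k).
(* The square root is at most [Y ^+ 2 = Num.sqrt v] after multiplication by [a], because
   [a ^+ 2 <= a * alpha]; the term in [L] is absorbed by [a_psi_L]. *)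
have tle : psiB ^+ 2 * t <= 1920 * alpha * (psiB ^+ 2 * Y ^+ 2) + 1920 * (alpha * X).
  have h1 : a * Num.sqrt (sigma * L) <= Y ^+ 2.
    have -> : a * Num.sqrt (sigma * L) = Num.sqrt (a ^+ 2 * (sigma * L)).
      by rewrite [RHS]sqrtrM ?sqr_ge0// sqrtr_sqr ger0_norm// ltW.
    rewrite Y2 ler_sqrt// /v -[leRHS]mulrA; apply: ler_wpM2r; first exact: mulr_ge0.
    by rewrite expr2 ler_pM2l.
  have h2 := ler_wpM2l (mulr_ge0 (ltW alpha_gt0) (sqr_ge0 psiB)) h1.
  rewrite /t; have := a_psi_L; lra.
have W2 : X + psiB ^+ 2 * Y ^+ 2 <= (Num.sqrt X + psiB * Y) ^+ 2.
  have cross : 0 <= Num.sqrt X * (psiB * Y).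
    by apply: mulr_ge0; [exact: sqrtr_ge0|exact: mulr_ge0].
  rewrite sqrrD sqr_sqrtr// [in leRHS]exprMn mulr2n; lra.
(* The squares need only the constant 2000, whereas the stated bound supplies its square. *)
have kappa : 2000 <= 2000 ^+ 2 :> R by rewrite ler_eXnr// ler1n.
rewrite FE !exprMn sqr_sqrtr; last exact: ltW.
apply: le_trans (lerD diag_le offdiag_le) _.
apply: (@le_trans _ _ (2000 * (Num.sqrt X + psiB * Y) ^+ 2 * beta ^+ 2 *
    alpha)); last first.
  apply: ler_wpM2r; first exact: ltW.
  by do 2!(apply: ler_wpM2r; first exact: sqr_ge0).
rewrite exprMn.
have -> : 18 * (alpha * X) * beta ^+ 2 +
    (alpha * X * beta ^+ 2 + psiB ^+ 2 * beta ^+ 2 * t) =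
    (19 * (alpha * X) + psiB ^+ 2 * t) * beta ^+ 2 by ring.
rewrite [leRHS]mulrAC; apply: ler_wpM2r; first exact: sqr_ge0.
have := ler_wpM2l (ltW alpha_gt0) W2.
have : 0 <= alpha * (psiB ^+ 2 * Y ^+ 2).
  by apply: mulr_ge0; [exact: ltW|nonneg].
have : 0 <= alpha * X by rewrite mulr_ge0// ltW.
move: tle; lra.
Qed.

End MaskBound.

(** * The law of the mask *)

Section MaskLaw.
Context {R : realType} {m n : nat} (p : 'I_m -> R).
Hypothesis p01 : forall k, 0 <= p k <= 1.

Definition bern (r : R) (b : bool) : R := if b then r else 1 - r.

(** A whole column is one variable: in the tail bounds [I] indexes columns, and [y] and [z] are two
    functions, possibly dependent, of the same column. *)
Definition column_pmf (k : 'I_m) : {ffun 'I_n -> bool} -> R :=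
  prodpmf (fun=> bern (p k)).

Let bern_pmf k : is_pmf (bern (p k)).
Proof.
have /andP[p0 p1] := p01 k; split=> [[]|]; rewrite /bern ?subr_ge0//.
by rewrite big_bool /= addrC subrK.
Qed.

Lemma column_pmf_is_pmf k : is_pmf (column_pmf k).
Proof. exact: prodpmf_is_pmf. Qed.

Definition both (z : 'I_n * 'I_n) (c : {ffun 'I_n -> bool}) : R :=
  (c z.1 && c z.2)%:R.

Lemma both01 z c : 0 <= both z c <= 1.
Proof. by rewrite /both; case: (c _ && _); rewrite ?lexx ?ler01. Qed.

(** Two distinct entries of a column are independent; for [z.1 = z.2] the mean would be [p k]
    instead. *)
Lemma Ex_both z k : z.1 != z.2 -> Ex (column_pmf k) (both z) = p k ^+ 2.
Proof.
move=> zz; rewrite (@eq_Ex _ _ _ _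
  (fun c : {ffun 'I_n -> bool} => (c z.1)%:R * (c z.2)%:R)); last first.
  by move=> c; rewrite /both; case: (c z.1); rewrite ?mul1r ?mul0r.
rewrite (Ex_prodpmf_proj2 (fun b : bool => b%:R) (fun b : bool => b%:R)) //.
by rewrite /Ex big_bool /bern /= mulr1 mulr0 addr0 expr2.
Qed.

Context (d : measure_display) (T : measurableType d) (P : probability T R).
Context (U : 'I_n -> 'I_m -> {RV P >-> bool}).
Hypothesis lawU : forall i k, distribution P (U i k) =1 bernoulli_prob (p k).
Hypothesis indepU :
  mutually_independent P (fun ik : 'I_n * 'I_m => U ik.1 ik.2).

Definition mask (x : T) : {ffun 'I_m -> {ffun 'I_n -> bool}} :=
  [ffun k => [ffun i => U i k x]].

Let mask_cap v : [set x | mask x = v] =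
  \bigcap_(ik in [set` [set: 'I_n * 'I_m]%SET])
    U ik.1 ik.2 @^-1` [set v ik.2 ik.1].
Proof.
apply/seteqP; split=> x /=.
  by move=> <- ik _ /=; rewrite !ffunE.
move=> h; apply/ffunP => k; apply/ffunP => i; rewrite !ffunE.
by apply: (h (i, k)) => /=; rewrite inE.
Qed.

Lemma measurable_mask v : measurable [set x | mask x = v].
Proof.
rewrite mask_cap; apply: fin_bigcap_measurable => // ik _.
exact: measurable_funPTI.
Qed.

Lemma mask_law v : P [set x | mask x = v] = (prodpmf column_pmf v)%:E.
Proof.
rewrite mask_cap indepU//.
have pE ik : P (U ik.1 ik.2 @^-1` [set v ik.2 ik.1]) =
    (bern (p ik.2) (v ik.2 ik.1))%:E.
  rewrite -[LHS]/(distribution P (U ik.1 ik.2) [set v ik.2 ik.1]) lawU.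
  rewrite bernoulli_probE// !diracE /bern; case: (v _ _).
    by rewrite mem_set// memNset//= mule1 mule0 adde0.
  by rewrite memNset// mem_set//= mule1 mule0 add0e.
under eq_bigr do rewrite pE.
rewrite prodEFin; congr _%:E.
rewrite (eq_bigl xpredT) => [|ik]; last by rewrite inE.
rewrite -(pair_bigA _ (fun i k => bern (p k) (v k i)))/= exchange_big.
by apply: eq_bigr => k _.
Qed.

Let mask_cup (bad : pred {ffun 'I_m -> {ffun 'I_n -> bool}}) :
  [set x | bad (mask x)] = \big[setU/set0]_(v | bad v) [set x | mask x = v].
Proof.
rewrite -(@bigcup_pred _ _ bad); apply/seteqP; split=> x /=.
  by move=> bx; exists (mask x).
by move=> [v bv ->].
Qed.

Lemma measurable_mask_pred (bad : pred {ffun 'I_m -> {ffun 'I_n -> bool}}) :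
  measurable [set x | bad (mask x)].
Proof.
by rewrite mask_cup; apply: bigsetU_measurable => v _; exact: measurable_mask.
Qed.

(** The event is a finite union of atoms, so subadditivity and [mask_law] carry bounds on finite
    sums over to [P]. *)
Lemma mask_prob_le (bad : pred {ffun 'I_m -> {ffun 'I_n -> bool}}) :
  (P [set x | bad (mask x)] <=
   (Ex (prodpmf column_pmf) (fun v => (bad v)%:R))%:E)%E.
Proof.
have -> : Ex (prodpmf column_pmf) (fun v => (bad v)%:R) =
    \sum_(v | bad v) prodpmf column_pmf v.
  rewrite [RHS]big_mkcond; apply: eq_bigr => v _.
  by case: (bad v); rewrite ?mulr1 ?mulr0.
rewrite mask_cup -sumEFin.
pose K (S : set T) (x : \bar R) := measurable S /\ (P S <= x)%E.
suff [] : K (\big[setU/set0]_(v | bad v) [set x | mask x = v])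
  (\sum_(v | bad v) (prodpmf column_pmf v)%:E)%E by [].
apply: (big_ind2 K) => [|S1 x1 S2 x2 [m1 h1] [m2 h2]|v _].
- by split; rewrite ?measure0.
- split; first exact: measurableU.
  by apply: le_trans (measureU2 _ m1 m2) _; exact: leeD.
- by split; [exact: measurable_mask|rewrite mask_law].
Qed.

End MaskLaw.

(** * Union bound over two pairs of indices *)

Section BadMasks.
Context {R : realType} {m n : nat} (A0 SA : 'M[R]_m) (p : 'I_m -> R) (L : R).
Hypotheses (m_gt0 : (0 < m)%N) (spdA : spd A0) (sqrtA : is_spd_sqrt A0 SA).
Hypothesis p01 : forall k, 0 <= p k <= 1.
Hypothesis L0 : 0 <= L.

Let a := max_diag A0.
Let alpha := opnorm A0.

Definition bad_diag (z : 'I_n * 'I_n)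
    (v : {ffun 'I_m -> {ffun 'I_n -> bool}}) : bool :=
  2 * (\sum_k A0 k k ^+ 2 * p k ^+ 2) + 16 * a ^+ 2 * L <=
  \sum_k A0 k k ^+ 2 * both z (v k).

Definition bad_offdiag (z z' : 'I_n * 'I_n)
    (v : {ffun 'I_m -> {ffun 'I_n -> bool}}) : bool :=
  1920 * (alpha * a) * (Num.sqrt ((\sum_k (p k ^+ 2) ^+ 2) * L) + L) <=
  `|\sum_k \sum_(l | l != k) A0 k l ^+ 2 *
     (both z (v k) * both z' (v l) - p k ^+ 2 * p l ^+ 2)|.

(** Neither [q] nor the sparsity level appears, so a single exceptional event serves all of them. *)
Definition bad_mask (v : {ffun 'I_m -> {ffun 'I_n -> bool}}) : bool :=
  [exists z, exists z', [&& z.1 != z.2, z'.1 != z'.2 &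
    bad_diag z v || bad_offdiag z z' v]].

Lemma bad_diag_prob z : z.1 != z.2 ->
  Ex (prodpmf (column_pmf p)) (fun v => (bad_diag z v)%:R) <= expR (- (8 * L)).
Proof.
move=> zz; apply: (diag_tail (s := fun k => p k ^+ 2)).
- by move=> k; exact: column_pmf_is_pmf.
- exact: both01.
- by move=> k; exact: Ex_both.
- move=> k; rewrite sqr_ge0 lerXn2r ?nnegrE ?diag_le_max//.
    exact: ltW (spd_diag_gt0 spdA k).
  exact: ltW (max_diag_gt0 m_gt0 spdA).
- by rewrite exprn_gt0// (max_diag_gt0 m_gt0 spdA).
Qed.

Lemma bad_offdiag_prob z z' : z.1 != z.2 -> z'.1 != z'.2 ->
  Ex (prodpmf (column_pmf p)) (fun v => (bad_offdiag z z' v)%:R) <=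
  2 * expR (- (8 * L)).
Proof.
move=> zz zz'.
apply: (@offdiag_tail _ _ _ _ (both z) (both z') (fun k => p k ^+ 2)
  _ _ _ _ _ (fun k l => A0 k l ^+ 2)).
- by move=> k; exact: column_pmf_is_pmf.
- exact: both01.
- exact: both01.
- by move=> k; exact: Ex_both.
- by move=> k; exact: Ex_both.
- by move=> k l; exact: sqr_ge0.
- by rewrite mulr_gt0 ?opnorm_spd_gt0//; exact: (max_diag_gt0 m_gt0 spdA).
- exact: L0.
- by move=> k; exact: (sqr_row_sum_le m_gt0 spdA sqrtA).
- move=> l; under eq_bigr do rewrite (spd_sym spdA).
  exact: (sqr_row_sum_le m_gt0 spdA sqrtA).
Qed.

(** There are [n ^ 4] choices of [z] and [z'], each with a diagonal tail of weight 1 and a two-sided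
    off-diagonal tail of weight 2. *)
Lemma bad_mask_prob :
  Ex (prodpmf (column_pmf p)) (fun v => (bad_mask v)%:R) <=
  n%:R ^+ 4 * (3 * expR (- (8 * L))).
Proof.
have pmf : is_pmf (prodpmf (@column_pmf R m n p)).
  by apply: prodpmf_is_pmf => k; exact: column_pmf_is_pmf.
pose f z z' v : R := [&& z.1 != z.2, z'.1 != z'.2 &
    bad_diag z v || bad_offdiag z z' v]%:R.
have f0 z z' v : 0 <= f z z' v by exact: ler0n.
apply: (@le_trans _ _ (Ex (prodpmf (column_pmf p))
    (fun v => \sum_z \sum_z' f z z' v))).
  apply: le_Ex => // v; have [|_] := boolP (bad_mask v); last first.
    by do 2![apply: sumr_ge0 => ? _].
  move=> /existsP[z /existsP[z' zz']].
  rewrite (bigD1 z)//= (bigD1 z')//= {1}/f zz' -addrA lerDl addr_ge0//.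
    exact: sumr_ge0.
  by do 2![apply: sumr_ge0 => ? _].
rewrite Ex_sum.
have -> : n%:R ^+ 4 * (3 * expR (- (8 * L))) =
    \sum_(z : 'I_n * 'I_n) \sum_(z' : 'I_n * 'I_n) 3 * expR (- (8 * L)).
  rewrite !sumr_const !card_prod !card_ord -mulrnA -[RHS]mulr_natl; congr (_ * _).
  by rewrite -natrX !natrM; ring.
apply: ler_sum => z _; rewrite Ex_sum; apply: ler_sum => z' _.
have e0 : 0 <= 3 * expR (- (8 * L)) by rewrite mulr_ge0 ?expR_ge0.
have [zz|zz] := boolP (z.1 != z.2); last first.
  rewrite (@eq_Ex _ _ _ _ (fun=> 0)) ?Ex_cst// => v.
  by rewrite /f (negPf zz).
have [zz'|zz'] := boolP (z'.1 != z'.2); last first.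
  rewrite (@eq_Ex _ _ _ _ (fun=> 0)) ?Ex_cst// => v.
  by rewrite /f (negPf zz') andbF.
apply: (@le_trans _ _ (Ex (prodpmf (column_pmf p))
    (fun v => (bad_diag z v)%:R + (bad_offdiag z z' v)%:R))).
  apply: le_Ex => // v; rewrite /f zz zz' /=.
  by case: (bad_diag z v); case: (bad_offdiag z z' v); rewrite /= ?addr0 ?add0r// lerDl.
rewrite ExD; have := bad_diag_prob zz; have := bad_offdiag_prob zz zz'; lra.
Qed.

End BadMasks.

(** * The exceptional event and the absolute constants *)

Theorem theorem4p4 (R : realType) :
  exists c C C' : R, [/\ 0 < c, 0 < C & 0 < C'] /\
  forall (m n : nat) (A0 SA : 'M[R]_m) (B0 SB : 'M[R]_n) (p : 'I_m -> R)
    (d : measure_display) (T : measurableType d) (P : probability T R)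
    (U : 'I_n -> 'I_m -> {RV P >-> bool}),
  (0 < m)%N -> (0 < n)%N ->
  spd A0 -> spd B0 -> \tr B0 = n%:R ->
  is_spd_sqrt A0 SA -> is_spd_sqrt B0 SB ->
  (forall k, 0 <= p k <= 1) ->
  (forall i k, distribution P (U i k) =1 bernoulli_prob (p k)) ->
  mutually_independent P (fun ik : 'I_n * 'I_m => U ik.1 ik.2) ->
  exists E : set T,
    [/\ measurable E,
        ((1 - c / (maxn n m)%:R ^+ 4)%:E <= P E)%E &
        forall w, E w -> forall s0 : nat, (1 <= s0 <= n)%N ->
          C * psi B0 s0 ^+ 2 * ln (maxn n m)%:R
            <= (\sum_j A0 j j * p j ^+ 2) / opnorm A0 ->
          (ereal_sup [set (frobnorm (Adiamond SA SB (fun i k => U i k w) q))%:E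
                     | q in sparse_sphere n s0]
            <= (C' * Wbound A0 B0 p s0 * opnorm B0
                * Num.sqrt (opnorm A0))%:E)%E].
Proof.
(* The 3 is that of [bad_mask_prob]: at [L = ln N] the exponential is [N ^- 8], and [n <= N] leaves
   [3 / N ^+ 4]. The 1 matches [effective_rank], and 2000 is the constant of
   [frobnorm_Adiamond_le]. *)
exists 3, 1, 2000; split; first by split; rewrite ?ltr01 ?ltr0n.
move=> m n A0 SA B0 SB p d T P U m0 n0 spdA spdB _ sqrtA sqrtB p01 lawU indepU.
set N : R := (maxn n m)%:R; pose L := ln N.
have N1 : 1 <= N by rewrite ler1n leq_max n0.
have L0 : 0 <= L by exact: ln_ge0.
have N0 : 0 < N by exact: lt_le_trans N1.
have mbad := measurable_mask_pred U (bad_mask A0 p L).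
exists (~` [set x | bad_mask A0 p L (mask U x)]); split.
- exact: measurableC.
- rewrite probability_setC// EFinB leeB//.
  apply: le_trans (mask_prob_le p01 lawU indepU _) _; rewrite lee_fin.
  apply: (le_trans (@bad_mask_prob R m n A0 SA p L m0 spdA sqrtA p01 L0)).
  have -> : expR (- (8 * L)) = (N ^+ 8)^-1.
    by rewrite expRN expRM_natl lnK ?posrE.
  have -> : 3 / N ^+ 4 = N ^+ 4 * (3 * (N ^+ 8)^-1).
    by field; rewrite gt_eqF.
  rewrite ler_wpM2r//; first by rewrite mulr_ge0// invr_ge0 exprn_ge0// ltW.
  by rewrite lerXn2r ?nnegrE ?ler0n// ler_nat leq_maxl.
move=> w /= /negP good s0 _; rewrite mul1r => rank.
apply: ge_ereal_sup => _ [q qs <-]; rewrite lee_fin.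
have yE z k : (U z.1 k w && U z.2 k w)%:R = both z (mask U w k) :> R.
  by rewrite /both !ffunE.
apply: (frobnorm_Adiamond_le m0 n0 spdA spdB sqrtA sqrtB p01 qs L0 _ _ rank).
- move=> z zz; apply: ltW; rewrite ltNge; apply: contra good => h.
  (* The diagonal bound concerns [z] alone, so [z] itself fills the place of [z']. *)
  apply/existsP; exists z; apply/existsP; exists z; rewrite zz /=.
  apply/orP; left; apply: le_trans h _.
  by apply: ler_sum => k _; rewrite yE.
- move=> z z' zz zz'; apply: ltW; rewrite ltNge; apply: contra good => h.
  apply/existsP; exists z; apply/existsP; exists z'; rewrite zz zz' /=.
  apply/orP; right; apply: le_trans h _; rewrite le_eqVlt; apply/orP; left.
  apply/eqP; congr `|_|; apply: eq_bigr => k _; apply: eq_bigr => l _.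
  by rewrite !yE.
Qed.
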